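(* Tabled evaluation $\textsf{Tabled}(q_0)$ of the five semantic equations never returns a wrong answer, even when the dependency graph $G$ is infinite. Specifically: (1) (Soundness, no false positives.) Every fact returned by tabling was produced by evaluating some equation's right-hand side on its inputs, and every returned fact belongs to $\mathrm{lfp}(T_P)$. (2) (Monotone accumulation.) The tabling accumulator only grows between iterations via set union; no fact is ever removed. (3) (Correct fixpoint detection.) If no sub-query was re-entered during evaluation, all sub-queries were fully computed with no approximation, and the result is exact. If re-entry occurred but the accumulator is stable, meaning no new facts were added, the accumulator equals $\mathrm{lfp}(T_P)$ restricted to the reachable queries, since it is a sound pre-fixed point and the least fixed point is the least pre-fixed point. (4) (Sound failure.) When the iteration does not stabilize, the algorithm does not return; it never returns a wrong answer.
   Context: **Documents.** A node is a scalar (a tag and a string), a sequence (a tag and a finite list of nodes) or a mapping (a tag and a finite list of pairs of nodes). The relevant tags are !!seq, !!map, !!str, !!null. A program (document, AST) is a node $\mathrm{doc}$. Labels are strings; a path is a finite sequence of labels; $()$ is the root path; $p\triangleright\ell$ appends a label; $p\frown w$ concatenates a label sequence; for $p\ne()$, $\mathrm{init}(p)$ drops the last label and $\mathrm{last}(p)$ is the last label (both undefined at $()$). Set comprehensions silently omit terms in which a partial function is undefined, and are empty if their source is undefined. **Syntactic helpers.** $\mathrm{items}(\mathit{node})$ is the list of children if $\mathit{node}$ is a !!seq sequence (undefined otherwise). $\mathrm{kv}(\mathit{node})=(\ell,m)$ if $\mathit{node}$ is a !!map mapping with exactly one pair, whose key is a !!str scalar with content $\ell$ and whose value is $m$ (undefined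 otherwise). $\mathrm{at}(())=\mathrm{doc}$; $\mathrm{at}(p\triangleright\ell)$ is the unique $m$ with $(\ell,m)=\mathrm{kv}(\mathit{node})$ for some $\mathit{node}\in\mathrm{items}(\mathrm{at}(p))$. $\mathrm{has}(p,\ell)$ holds iff some $\mathit{node}\in\mathrm{items}(\mathrm{at}(p))$ has $\mathrm{kv}(\mathit{node})=(\ell,\_)$. $\mathrm{lexical}(p,\ell)=0$ if $\mathrm{has}(p,\ell)$, else $1+\mathrm{lexical}(\mathrm{init}(p),\ell)$. $\mathrm{qualified}(p,\ell)=0$ if $\mathrm{last}(p)=\ell$, else $1+\mathrm{qualified}(\mathrm{init}(p),\ell)$. For a list of scalars $r=(s_1,\dots,s_k)$: if $s_2$ is !!null, $\mathrm{indexed}(p,r)=(\mathrm{qualified}(\mathrm{init}(p),s_1),(s_3,\dots,s_k))$; otherwise $\mathrm{indexed}(p,r)=(\mathrm{lexical}(\mathrm{init}(p),s_1),(s_1,\dots,s_k))$ (scalars read as labels, requiring !!str). $\mathrm{dom}(\mathrm{inherits})=\{p: p=()\text{ or }\mathrm{has}(\mathrm{init}(p),\mathrm{last}(p))\}$, and for $p$ in it $\mathrm{inherits}(p)=\{\mathrm{indexed}(p,\mathrm{items}(r)) : r\in\mathrm{items}(\mathrm{at}(p))\}\subseteq\mathbb N\times\mathrm{Label}^*$. **Equations.** - $\mathrm{supers}(())=\{((),())\}$; $\mathrm{supers}(p\triangleright\ell)=\{(\mathrm{init}(b),o): b\in\mathrm{bases}^*(p\triangleright\ell),\ o\in\mathrm{overrides}(b)\}$,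 with $\mathrm{bases}^*$ the reflexive-transitive closure; - $\mathrm{overrides}(())=\{()\}$; $\mathrm{overrides}(p\triangleright\ell)=\{o : (\_,b)\in\mathrm{supers}(p),\ b\triangleright\ell\in\mathrm{dom}(\mathrm{inherits}),\ o\in\{p\triangleright\ell,\,b\triangleright\ell\}\}$; - $\mathrm{bases}(())=\varnothing$; $\mathrm{bases}(p\triangleright\ell)=\{t : o\in\mathrm{overrides}(p\triangleright\ell),\ (n,w)\in\mathrm{inherits}(o),\ t\in\mathrm{resolve}(p,o,n,w)\}$; - $\mathrm{resolve}(s,d,n,w)=\{c\frown w : c\in\mathrm{this}(\{s\},\mathrm{init}(d),n)\}$; - $\mathrm{this}(S,d,0)=S$; for $n>0$, $\mathrm{this}(S,d,n)=\mathrm{this}(\{t: c\in S,\ (t,d)\in\mathrm{supers}(c)\},\mathrm{init}(d),n-1)$. **Dependency graph and operator $T_P$.** Let $\mathcal Q$ be the set of all queries, i.e. semantic-function applications $\mathrm{supers}(p)$, $\mathrm{overrides}(p)$, $\mathrm{bases}(p)$, $\mathrm{resolve}(s,d,n,w)$, $\mathrm{this}(S,d,n)$ arising from the AST. For $q\in\mathcal Q$ let $\mathcal V_q$ be the set of pairs of paths if $q$ is a $\mathrm{supers}$ query, and the set of paths otherwise. A query--answer map is an element $M$ of $\prod_{q\in\mathcal Q}\mathcal P(\mathcal V_q)$, ordered by pointwise inclusion; a fact is a query together with one of its answers. $T_P(M)(q)$ is the set of values produced by all instances of the right-hand side of the equation for $q$, with every sub-query $q'$ read as $M(q')$; $\mathrm{bases}^*$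 is the reflexive-transitive closure of the relation assembled from the values $M(\mathrm{bases}(\cdot))$; and the $\mathrm{this}$ equation is unfolded per singleton frontier: for a general frontier $S$, $T_P(M)(\mathrm{this}(S,d,n))$ collects $\bigcup_{s\in S}M(\mathrm{this}(\{s\},d,n))$; at a singleton frontier, $T_P(M)(\mathrm{this}(\{s\},d,0))=\{s\}$ and, for $n>0$, $T_P(M)(\mathrm{this}(\{s\},d,n))=\bigcup_{(t,d)\in M(\mathrm{supers}(s))}M(\mathrm{this}(\{t\},\mathrm{init}(d),n-1))$. $T_P$ is monotone; $\mathrm{lfp}(T_P)$ is its least fixed point. The dependency graph $G$ has the queries as vertices and a directed edge $u\to v$ when the right-hand side defining $u$ reads the value of $v$ under some query--answer map. The reachable queries are the queries reachable from the initial query $q_0$; this set is closed under the dependency edges of $G$ (every sub-query a reachable query reads is itself reachable). **Algorithm.** State: $\mathit{approx}$ (the accumulator), every query's answer set so far, kept across rounds, empty until produced; $\mathit{cache}$, the queries recomputed in the current round; $\mathit{stack}$, the queries being computed. $\textsf{Resolve}(q)$: if $q\in\mathit{cache}$ return $\mathit{approx}[q]$; if $q\in\mathit{stack}$ (re-entry) return $\mathit{approx}[q]$; otherwise add $q$ to $\mathit{stack}$, let $\mathit{produced}$ be the values of all instances of the right-hand side of $q$'s equation with every sub-query fact read through $\textsf{Resolve}$, remove $q$ from $\mathit{stack}$, set $\mathit{changed}$ to true if $\mathit{produced}\not\subseteq\mathit{approx}[q]$, set $\mathit{approx}[q]:=\mathit{approx}[q]\cup\mathit{produced}$, add $q$ to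 $\mathit{cache}$, return $\mathit{approx}[q]$. $\textsf{Tabled}(q_0)$: repeat rounds ($\mathit{cache}:=\emptyset$, $\mathit{stack}:=\emptyset$, $\mathit{changed}:=$ false, call $\textsf{Resolve}(q_0)$) until a round ends with $\mathit{changed}$ false; then return $\mathit{approx}[q_0]$.
   Formalization: In (3), ''reachable queries'' means those reached from q_0 by sub-query reads made under lfp(T_P), not under some query–answer map: along all edges of G the claim is false, as never-demanded queries have an empty accumulator but may have facts in lfp(T_P). *)

(* Defs.v *)
From Stdlib Require Import String Relation_Operators.
From mathcomp Require Import all_boot.
From mathcomp Require Import boolp classical_sets.

Set Implicit Arguments.
Unset Strict Implicit.
Unset Printing Implicit Defensive.

Local Open Scope classical_set_scope.

Inductive node : Type :=
| Scalar of string & string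
| Sequence of string & seq node
| Mapping of string & seq (node * node).

Definition tag_seq : string := "!!seq"%string.
Definition tag_map : string := "!!map"%string.
Definition tag_str : string := "!!str"%string.
Definition tag_null : string := "!!null"%string.

Definition label := string.

(** The root path is [[::]], [rcons p l] appends a label and [p ++ w]
    concatenates.  The partial functions init and last are written through
    [rcons]: "init(p) is defined and equal to p'" is [p = rcons p' l] for
    some [l]. *)
Definition docpath := seq label.

(** A partial function is an [option]-valued function when it is a local
    syntactic test, and its graph (a relation) when it recurses on a path or
    depends on the document. *)

Definition items (x : node) : option (seq node) :=
  match x with
  | Sequence t xs => if String.eqb t tag_seq then Some xs else None
  | _ => None
  end.

Definition kv (x : node) : option (label * node) :=
  match x with
  | Mapping t [:: (Scalar t' l, m)] =>
      if String.eqb t tag_map && String.eqb t' tag_str then Some (l, m)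
      else None
  | _ => None
  end.

Definition entry (x : node) (l : label) (m : node) : Prop :=
  exists xs y, [/\ items x = Some xs, List.In y xs & kv y = Some (l, m)].

Inductive node_at (doc : node) : docpath -> node -> Prop :=
| node_at_root : node_at doc [::] doc
| node_at_rcons p l x m :
    node_at doc p x -> entry x l m -> (forall m', entry x l m' -> m' = m) ->
    node_at doc (rcons p l) m.

Definition has_label (doc : node) (p : docpath) (l : label) : Prop :=
  exists x m, node_at doc p x /\ entry x l m.

Inductive lexical (doc : node) : docpath -> label -> nat -> Prop :=
| lexical_here p l : has_label doc p l -> lexical doc p l 0
| lexical_up p l' l n :
    ~ has_label doc (rcons p l') l -> lexical doc p l n ->
    lexical doc (rcons p l') l n.+1.

Inductive qualified : docpath -> label -> nat -> Prop :=
| qualified_here p l : qualified (rcons p l) l 0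
| qualified_up p l' l n :
    l' <> l -> qualified p l n -> qualified (rcons p l') l n.+1.

Definition as_label (x : node) : option label :=
  match x with
  | Scalar t s => if String.eqb t tag_str then Some s else None
  | _ => None
  end.

Definition is_null (x : node) : bool :=
  match x with
  | Scalar t _ => String.eqb t tag_null
  | _ => false
  end.

(** [indexed doc p r n w] is indexed(p, r) = (n, w).  With [r = s1 :: r1], the
    scalar s_2, if there is one, is the head of [r1]. *)
Definition indexed (doc : node) (p : docpath) (r : seq node)
    (n : nat) (w : seq label) : Prop :=
  exists p' l s1 r1 l1,
    [/\ p = rcons p' l, r = s1 :: r1, as_label s1 = Some l1
      & if (if r1 is s2 :: _ then is_null s2 else false)
        then qualified p' l1 n /\ map as_label (behead r1) = map Some w
        else lexical doc p' l1 n /\ map as_label r = map Some w].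

Definition dom_inherits (doc : node) (p : docpath) : Prop :=
  p = [::] \/ exists p' l, p = rcons p' l /\ has_label doc p' l.

Definition inherits (doc : node) (p : docpath) (n : nat) (w : seq label)
  : Prop :=
  dom_inherits doc p /\
  exists x rs r xs,
    [/\ node_at doc p x, items x = Some rs, List.In r rs, items r = Some xs
      & indexed doc p xs n w].

Inductive query : Type :=
| Supers of docpath
| Overrides of docpath
| Bases of docpath
| Resolve of docpath & docpath & nat & seq label
| This of set docpath & docpath & nat.

Definition ans (q : query) : Type :=
  match q with
  | Supers _ => (docpath * docpath)%type
  | _ => docpath
  end.

Definition qmap := forall q : query, set (ans q).

Definition le_qmap (M N : qmap) : Prop := forall q, M q `<=` N q.

Definition empty_qmap : qmap := fun q => set0.

(** [upd M q A] adds to [M] the facts [(q, v)] for [v] in [A]; the dependent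
    pairs avoid casting [A] along an equality of queries. *)
Definition upd (M : qmap) (q : query) (A : set (ans q)) : qmap :=
  fun q' v' => M q' v' \/ exists2 v, A v & existT ans q v = existT ans q' v'.

Definition bases_star (M : qmap) : docpath -> docpath -> Prop :=
  clos_refl_trans docpath (fun a b => M (Bases a) b).

Definition singleton_frontier (X : set docpath) : Prop :=
  exists s, X = [set s].

Definition TP (doc : node) (M : qmap) (q : query) : set (ans q) :=
  match q return set (ans q) with
  | Supers p => [set y |
      (p = [::] /\ y = ([::], [::])) \/
      (p <> [::] /\ exists b l,
         [/\ bases_star M p b, M (Overrides b) y.2 & b = rcons y.1 l])]
  | Overrides p => [set o |
      (p = [::] /\ o = [::]) \/
      (exists p' l a b,
         [/\ p = rcons p' l, M (Supers p') (a, b),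
             dom_inherits doc (rcons b l)
           & o = rcons p' l \/ o = rcons b l])]
  | Bases p => [set t |
      exists p' l o n w,
        [/\ p = rcons p' l, M (Overrides p) o, inherits doc o n w
          & M (Resolve p' o n w) t]]
  | Resolve s d n w => [set t |
      exists d' l c,
        [/\ d = rcons d' l, M (This [set s] d' n) c & t = c ++ w]]
  | This X d n => [set t |
      (exists2 s, X = [set s] &
         match n with
         | 0 => t = s
         | n'.+1 => exists d' l t',
             [/\ d = rcons d' l, M (Supers s) (t', d)
               & M (This [set t'] d' n') t]
         end) \/
      (~ singleton_frontier X /\ exists2 s, X s & M (This [set s] d n) t)]
  end.

Arguments TP doc M q : clear implicits.

Definition lfp (T : qmap -> qmap) : qmap :=
  fun q => [set v | forall M, T M = M -> M q v].

Arguments lfp T q : clear implicits.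

(** [reads doc M u v]: evaluating the right-hand side of the equation of [u]
    with sub-queries answered by [M] reads the value of [v]. *)

Definition reads (doc : node) (M : qmap) (u v : query) : Prop :=
  match u with
  | Supers p =>
      p <> [::] /\
      exists2 b, bases_star M p b & v = Bases b \/ v = Overrides b
  | Overrides p => exists p' l, p = rcons p' l /\ v = Supers p'
  | Bases p =>
      exists p' l, p = rcons p' l /\
        (v = Overrides p \/
         exists o n w, [/\ M (Overrides p) o, inherits doc o n w
                         & v = Resolve p' o n w])
  | Resolve s d n w => exists d' l, d = rcons d' l /\ v = This [set s] d' n
  | This X d n =>
      (exists s n', [/\ X = [set s], n = n'.+1
         & v = Supers s \/
           exists d' l t, [/\ d = rcons d' l, M (Supers s) (t, d)
                            & v = This [set t] d' n']]) \/
      (~ singleton_frontier X /\ exists2 s, X s & v = This [set s] d n)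
  end.

(** The dependency graph G is the relation [dep_edge doc]. *)
Definition dep_edge (doc : node) (u v : query) : Prop :=
  exists M, reads doc M u v.

(** The reachable queries are closed under actual reads, that is, under the
    edges of G that are read under lfp(T_P).  Following every edge of G would
    also include queries demanded only by facts that are never true (with an
    arbitrary map M, [Supers p] for p nonempty reads [Overrides b] for every
    path [b]); no evaluation reads those, so the accumulator is empty there
    whereas lfp(T_P) need not be. *)
Definition reachable (doc : node) (q0 : query) : query -> Prop :=
  clos_refl_trans query (reads doc (lfp (TP doc))) q0.

Lemma reachable_dep (doc : node) (q0 q : query) :
  reachable doc q0 q -> clos_refl_trans query (dep_edge doc) q0 q.
Proof.
elim=> [u v uv|u|u v w _ IH1 _ IH2].
- by apply: rt_step; exists (lfp (TP doc)).
- exact: rt_refl.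
- exact: rt_trans IH1 IH2.
Qed.

(** A frame is one evaluation of the right-hand side of [fquery]: [fread] are
    the sub-queries already read through Resolve, [fenv] the answers they
    returned.  A frame may read next any sub-query demanded by the answers
    obtained so far, in any order, and is complete when nothing demanded is
    left unread.  While a frame is on the stack a sub-query it has read is
    cached or on the stack, so reading it again would return the same set. *)

Record frame := Frame {
  fquery : query;
  fread : set query;
  fenv : qmap }.

Definition new_frame (q : query) : frame := Frame q set0 empty_qmap.

Definition demanded (doc : node) (f : frame) (v : query) : Prop :=
  reads doc (fenv f) (fquery f) v /\ ~ fread f v.

Definition answer (f : frame) (v : query) (A : set (ans v)) : frame :=
  Frame (fquery f) (fread f `|` [set v]) (upd (fenv f) A).

(** The head of [stack] is the innermost call.  [result] is [Some A] once
    Tabled has returned [A]. *)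
Record config (q0 : query) := Config {
  approx : qmap;
  cache : set query;
  stack : seq frame;
  changed : bool;
  result : option (set (ans q0)) }.

Arguments approx {q0} c q : rename.

Definition on_stack (fs : seq frame) (q : query) : Prop :=
  exists2 f, List.In f fs & fquery f = q.

Definition init_config (q0 : query) : config q0 :=
  Config empty_qmap set0 [:: new_frame q0] false None.

Inductive event : Type :=
| EvCached of query & query
| EvReenter of query & query
| EvCall of query & query
| EvProduce of query & qmap
| EvNextRound
| EvReturn
| EvIdle.

Inductive step (doc : node) (q0 : query)
  : config q0 -> event -> config q0 -> Prop :=
| step_cached M C f fs ch v :
    demanded doc f v -> C v ->
    step doc (Config M C (f :: fs) ch None) (EvCached (fquery f) v)
             (Config M C (answer f (M v) :: fs) ch None)
| step_reenter M C f fs ch v :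
    demanded doc f v -> ~ C v -> on_stack (f :: fs) v ->
    step doc (Config M C (f :: fs) ch None) (EvReenter (fquery f) v)
             (Config M C (answer f (M v) :: fs) ch None)
| step_call M C f fs ch v :
    demanded doc f v -> ~ C v -> ~ on_stack (f :: fs) v ->
    step doc (Config M C (f :: fs) ch None) (EvCall (fquery f) v)
             (Config M C (new_frame v :: f :: fs) ch None)
| step_produce M C f fs ch :
    (forall v, ~ demanded doc f v) ->
    let q := fquery f in
    let produced := TP doc (fenv f) q in
    let M' := upd M produced in
    step doc (Config M C (f :: fs) ch None) (EvProduce q (fenv f))
             (Config M' (C `|` [set q])
                (if fs is g :: gs then answer g (M' q) :: gs else [::])
                (ch || ~~ `[< produced `<=` M q >]) None)
| step_next_round M C :
    step doc (Config M C [::] true None) EvNextRound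
             (Config M set0 [:: new_frame q0] false None)
| step_return M C :
    step doc (Config M C [::] false None) EvReturn
             (Config M C [::] false (Some (M q0)))
| step_idle M C fs ch A :
    step doc (Config M C fs ch (Some A)) EvIdle
             (Config M C fs ch (Some A)).

Lemma step_progress (doc : node) (q0 : query) (c : config q0) :
  exists ev c', step doc c ev c'.
Proof.
case: c => M C fs ch [A|]; first by do 2 eexists; exact: step_idle.
case: fs => [|f fs].
  by case: ch; do 2 eexists; [exact: step_next_round | exact: step_return].
have [[v dv]|nd] := pselect (exists v, demanded doc f v); last first.
  by do 2 eexists; apply: step_produce => v dv; apply: nd; exists v.
have [Cv|nCv] := pselect (C v); first by do 2 eexists; exact: step_cached dv Cv.
have [sv|nsv] := pselect (on_stack (f :: fs) v).
  by do 2 eexists; exact: step_reenter dv nCv sv.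
by do 2 eexists; exact: step_call dv nCv nsv.
Qed.

(** An execution of Tabled(q0).  It is infinite: it idles after a return, and
    otherwise runs forever, within one round or through infinitely many. *)
Definition execution (doc : node) (q0 : query)
    (e : nat -> config q0) (ev : nat -> event) : Prop :=
  e 0 = init_config q0 /\ forall i, step doc (e i) (ev i) (e i.+1).

(** [e i] is the configuration at the beginning of a round and [e j] the one
    at the end of the same round. *)
Definition round (q0 : query) (e : nat -> config q0) (i j : nat) : Prop :=
  [/\ i < j, stack (e i) = [:: new_frame q0],
      forall k, i <= k < j -> stack (e k) <> [::] & stack (e j) = [::]].

Definition reentered (ev : nat -> event) (i j : nat) : Prop :=
  exists k u v, i <= k < j /\ ev k = EvReenter u v.

(** No new fact was added between [e i] and [e j]. *)
Definition stable (q0 : query) (e : nat -> config q0) (i j : nat) : Prop :=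
  forall q, approx (e j) q = approx (e i) q.

(** [(q, v)] was produced before time [i] by evaluating the right-hand side of
    the equation of [q] on answers that the accumulator already held. *)
Definition produced_before (doc : node) (q0 : query) (e : nat -> config q0)
    (ev : nat -> event) (i : nat) (q : query) (v : ans q) : Prop :=
  exists k env, [/\ k < i, ev k = EvProduce q env,
                    le_qmap env (approx (e k)) & TP doc env q v].

(* Main.v *)
Require Import Defs.
From Stdlib Require Import Relation_Operators Operators_Properties Eqdep.
From mathcomp Require Import all_boot.
From mathcomp Require Import boolp classical_sets.

Set Implicit Arguments.
Unset Strict Implicit.
Unset Printing Implicit Defensive.

Local Open Scope classical_set_scope.

(** Both [TP] and [reads] are local: if [N] is below [M] on the sub-queries that
    the right-hand side of [q] reads under [M], then evaluating it under [N]
    gives nothing more than under [M].  Hence a frame that has read everything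
    it demands sees the same right-hand side as the map its answers come from.
    Without re-entry that map is the least fixed point, by induction on the
    order in which queries enter the cache.  If a round leaves the accumulator
    unchanged, that map is the accumulator itself; at the end of the round the
    cache is closed under reads and the accumulator is pre-fixed on it, so
    extending it by everything outside the cache gives a pre-fixed point, which
    bounds the least fixed point from above on the cache. *)

(** * Accumulating facts in a query-answer map *)

Lemma updE (M : qmap) (q : query) (A : set (ans q)) : @upd M q A q = M q `|` A.
Proof.
apply/seteqP; split=> v [Mv|]; [by left| |by left|by right; exists v].
by case=> v' Av' E; right; rewrite -(inj_pair2 _ _ _ _ _ E).
Qed.

Lemma le_upd (M : qmap) (q : query) (A : set (ans q)) : le_qmap M (upd M A).
Proof. by move=> q' v; left. Qed.

Lemma upd_le (M N : qmap) (q : query) (A : set (ans q)) :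
  le_qmap M N -> A `<=` N q -> le_qmap (upd M A) N.
Proof.
move=> MN AN q' v' [/MN//|[v Av E]].
have /= qE := projT1_eq E; subst q'.
by rewrite -(inj_pair2 _ _ _ _ _ E); exact: AN.
Qed.

Lemma qmap_eq (M N : qmap) : le_qmap M N -> le_qmap N M -> M = N.
Proof.
by move=> MN NM; apply: functional_extensionality_dep => q; apply/seteqP; split.
Qed.

(** * Locality and monotonicity of [TP] and [reads] *)

(** The chain is extended at its end: once [M] reaches [a], the query [Bases a] is itself read under
    [M], so the next link transfers. *)
Lemma bases_star_local (doc : node) (M N : qmap) (p b : docpath) :
  p <> [::] -> (forall v, reads doc M (Supers p) v -> N v `<=` M v) ->
  bases_star N p b -> bases_star M p b.
Proof.
move=> p0 NM /clos_rt_rtn1_iff; elim=> [|a c Nac _ IH]; first exact: rt_refl.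
apply: (rt_trans _ _ _ _ _ IH); apply: rt_step.
by apply: NM Nac; split=> //; exists a => //; left.
Qed.

(** Sub-queries are followed in order of discovery: each fact of [N] is first carried over to [M],
    which is what makes the next sub-query one that is read under [M]. *)
Lemma TP_local (doc : node) (M N : qmap) (q : query) :
  (forall v, reads doc M q v -> N v `<=` M v) -> TP doc N q `<=` TP doc M q.
Proof.
case: q => [p|p|p|s d n w|X d n] NM /= y.
- case=> [|[p0 [b [l [Nb No bE]]]]]; first by left.
  have Mb := bases_star_local p0 NM Nb.
  right; split=> //; exists b, l; split=> //.
  by apply: NM No; split=> //; exists b => //; right.
- case=> [|[p' [l [a [b [pE Na Db oE]]]]]]; first by left.
  right; exists p', l, a, b; split=> //.
  by apply: NM Na; exists p', l.
- case=> p' [l [o [n [w [pE No Io Nt]]]]].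
  have Mo : M (Overrides p) o.
    by apply: NM No; exists p', l; split=> //; left.
  exists p', l, o, n, w; split=> //.
  by apply: NM Nt; exists p', l; split=> //; right; exists o, n, w.
- case=> d' [l [c [dE Nc ->]]]; exists d', l, c; split=> //.
  by apply: NM Nc; exists d', l.
- case=> [[s XE ny]|[nX [s Xs Ny]]]; last first.
    right; split=> //; exists s => //.
    by apply: NM Ny; right; split=> //; exists s.
  left; exists s => //; case: n NM ny => [|n] // NM [d' [l [t [dE Ns Nt]]]].
  have Ms : M (Supers s) (t, d).
    by apply: NM Ns; left; exists s, n; split=> //; left.
  exists d', l, t; split=> //; apply: NM Nt; left; exists s, n; split=> //.
  by right; exists d', l, t.
Qed.

Lemma reads_local (doc : node) (M N : qmap) (q v : query) :
  (forall u, reads doc M q u -> N u `<=` M u) ->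
  reads doc N q v -> reads doc M q v.
Proof.
case: q => [p|p|p|s d n w|X d n] NM //=.
- by case=> p0 [b /(bases_star_local p0 NM) Mb bv]; split=> //; exists b.
- case=> p' [l [pE]] [->|[o [n [w [No Io ->]]]]]; exists p', l; split=> //.
    by left.
  right; exists o, n, w; split=> //.
  by apply: NM No; exists p', l; split=> //; left.
- case=> [[s [n' [XE nE]]]|]; last by right.
  case=> [->|[d' [l [t [dE Ns ->]]]]]; left; exists s, n'; split=> //.
    by left.
  right; exists d', l, t; split=> //.
  by apply: NM Ns; left; exists s, n'; split=> //; left.
Qed.

Lemma TP_mono (doc : node) (M N : qmap) :
  le_qmap M N -> le_qmap (TP doc M) (TP doc N).
Proof. by move=> MN q; apply: TP_local => v _; exact: MN. Qed.

Lemma reads_mono (doc : node) (M N : qmap) (q v : query) :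
  le_qmap M N -> reads doc M q v -> reads doc N q v.
Proof. by move=> MN; apply: reads_local => u _; exact: MN. Qed.

(** Knaster-Tarski. [lfp] intersects the fixed points only, so it is compared with [K], the
    intersection of the pre-fixed points: [K] is itself fixed, and every fixed point is
    pre-fixed. *)
Lemma lfp_fixed_least (doc : node) :
  TP doc (lfp (TP doc)) = lfp (TP doc) /\
  forall M, le_qmap (TP doc M) M -> le_qmap (lfp (TP doc)) M.
Proof.
pose K : qmap := fun q => [set v | forall M, le_qmap (TP doc M) M -> M q v].
have KM M : le_qmap (TP doc M) M -> le_qmap K M by move=> PM q v; apply.
have TK : le_qmap (TP doc K) K.
  by move=> q v Tv M PM; apply: (PM); apply: TP_mono Tv; exact: KM.
have KE : TP doc K = K by apply: qmap_eq => //; apply: KM; exact: TP_mono.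
suff -> : lfp (TP doc) = K by split.
apply: qmap_eq => q v; first by move/(_ K KE).
by move=> Kv M ME; apply: Kv; rewrite ME => ?.
Qed.

Definition lfp_fixed (doc : node) := (lfp_fixed_least doc).1.
Definition lfp_least (doc : node) := (lfp_fixed_least doc).2.

(** * Invariants of all configurations *)

(** [fread_visited] is the source of the closure of the cache under reads at the end of a stable
    round. [approx_reachable] keeps the accumulator empty off the reachable queries. *)
Record sound_config (doc : node) (q0 : query) (c : config q0) : Prop := {
  approx_sound : le_qmap (approx c) (lfp (TP doc));
  fenv_approx : forall f, List.In f (stack c) -> le_qmap (fenv f) (approx c);
  stack_reachable : forall f,
    List.In f (stack c) -> reachable doc q0 (fquery f);
  cache_reachable : forall q, cache c q -> reachable doc q0 q;
  approx_reachable : forall q v, approx c q v -> reachable doc q0 q;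
  fread_visited : forall f v, List.In f (stack c) -> fread f v ->
    cache c v \/ on_stack (stack c) v;
  q0_visited : cache c q0 \/ on_stack (stack c) q0;
  result_final : forall A, result c = Some A ->
    [/\ stack c = [::], changed c = false & A = approx c q0] }.

Lemma reads_fread (doc : node) (f : frame) :
  (forall v, ~ demanded doc f v) ->
  forall v, reads doc (fenv f) (fquery f) v -> fread f v.
Proof. by move=> nd v rv; apply: contrapT => nf; exact: (nd v). Qed.

Lemma sound_init (doc : node) (q0 : query) : sound_config doc (init_config q0).
Proof.
split=> //=; last by right; exists (new_frame q0) => //; left.
- by move=> q v.
- by move=> f [<-|//] q v.
- by move=> f [<-|//]; exact: rt_refl.
- by move=> f v [<-|].
Qed.

(** Shared by cached reads and re-entries, both of which answer with the current accumulator. *)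
Lemma sound_answer (doc : node) (q0 : query) (M : qmap) (C : set query)
    (f : frame) (fs : seq frame) (ch : bool) (v : query) :
  C v \/ on_stack (f :: fs) v ->
  @sound_config doc q0 (Config M C (f :: fs) ch None) ->
  @sound_config doc q0 (Config M C (answer f (M v) :: fs) ch None).
Proof.
have os u : on_stack (f :: fs) u -> on_stack (answer f (M v) :: fs) u.
  case=> g [<-|gs] <-; first by exists (answer f (M v)) => //; left.
  by exists g => //; right.
move=> Cv [Ml fM sr Cr Mr fv qv _]; split=> //=.
- move=> g [<-|gs]; last by apply: fM; right.
  by apply: upd_le; first by apply: fM; left.
- by move=> g [<-|gs]; [apply: (sr f); left|apply: sr; right].
- move=> g u [<-|gs] /=; last first.
    by move=> gu; case: (fv g u _ gu); [right|left|move/os; right].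
  case=> [fu|->]; last by case: Cv; [left|move/os; right].
  by case: (fv f u _ fu); [left|left|move/os; right].
- by case: qv => [|/os]; [left|right].
Qed.

Lemma sound_step (doc : node) (q0 : query) (c c' : config q0) (ev : event) :
  step doc c ev c' -> sound_config doc c -> sound_config doc c'.
Proof.
case=> {c c' ev} [M C f fs ch v dv Cv|M C f fs ch v dv _ Cv|M C f fs ch v dv _ _
  |M C f fs ch nd q produced M'|M C|M C|//].
- by apply: sound_answer; left.
- by apply: sound_answer; right.
- case=> /= Ml fM sr Cr Mr fv qv _; split=> //=.
  + by move=> g [<- u x|gs] //; exact: fM.
  + move=> g [<-|]; last exact: sr.
    (* [v] is read under the environment of [f], which lies below the least fixed point; as [reads]
       is monotone, this is an edge of [reachable]. *)
    apply: (rt_trans _ _ _ (fquery f)); first by apply: sr; left.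
    apply: rt_step; case: dv => + _; apply: reads_mono => u x fx.
    by apply: Ml; apply: fM fx; left.
  + move=> g u [<- //|gs gu].
    case: (fv g u gs gu) => [|[h hs hu]]; first by left.
    by right; exists h => //; right.
  + by case: qv => [|[h hs hu]]; [left|right; exists h => //; right].
- case=> /= Ml fM sr Cr Mr fv qv _.
  have qr : reachable doc q0 q by apply: (sr f); left.
  have fl : le_qmap (fenv f) (lfp (TP doc)).
    by move=> u x fx; apply: Ml; apply: fM fx; left.
  (* Popping [f] moves its query from the stack to the cache, so visited queries stay visited. *)
  have popped u : C u \/ on_stack (f :: fs) u ->
      (C `|` [set q]) u \/ on_stack fs u.
    by case=> [|[g [<-|gs] <-]]; [left; left|left; right|right; exists g].
  have os u : on_stack fs u ->
      on_stack (if fs is g :: gs then answer g (M' q) :: gs else [::]) u.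
    case: fs {fM sr fv qv popped} => [|g gs] // [h [<-|hs] <-].
      by exists (answer g (M' q)) => //; left.
    by exists h => //; right.
  split=> //=.
  (* The environment lies below [lfp], so monotonicity and the fixed-point equation bound what is
     produced. *)
  + apply: upd_le => // x px; rewrite -lfp_fixed; exact: (TP_mono fl).
  + have M'M : le_qmap M M' by exact: le_upd.
    case: fs fM {sr fv qv popped os} => [|g gs] // fM h [<-|hs] /=.
      by apply: upd_le => // u x gx; apply: M'M; apply: fM gx; right; left.
    by move=> u x hx; apply: M'M; apply: fM hx; right; right.
  + case: fs sr {fM fv qv popped os} => [|g gs] // sr h [<-|hs] /=.
      by apply: sr; right; left.
    by apply: sr; right; right.
  + by move=> u [/Cr|->].
  + move=> u x [/Mr//|[y _ E]].
    by have /= <- := projT1_eq E.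
  + move=> h u hs hu.
    suff : (C `|` [set q]) u \/ on_stack fs u by case=> [|/os]; [left|right].
    case: fs hs fv popped {fM sr qv os} => [|g gs] //= [hE|hs] fv popped.
      move: hu; rewrite -hE /= => -[gu|->]; last by left; right.
      by apply: popped; apply: fv gu; right; left.
    by apply: popped; apply: fv hu; right; right.
  + by case: (popped _ qv) => [|/os]; [left|right].
- case=> /= Ml fM sr Cr Mr fv qv _; split=> //=.
  + by move=> f [<-|//] q v.
  + by move=> f [<-|//]; exact: rt_refl.
  + by move=> f v [<-|].
  + by right; exists (new_frame q0) => //; left.
- by case=> /= Ml fM sr Cr Mr fv qv _; split=> //= A [<-].
Qed.

(** * Effect of one step on the accumulator, the cache and the flag *)

Lemma step_approx (doc : node) (q0 : query) (c c' : config q0) (ev : event)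
    (q : query) (v : ans q) :
  step doc c ev c' ->
  approx c' q v <->
  approx c q v \/ exists2 env, ev = EvProduce q env & TP doc env q v.
Proof.
case=> {c c' ev} /= [M C f fs ch u _ _|M C f fs ch u _ _ _|M C f fs ch u _ _ _
  |M C f fs ch nd|M C|M C|M C fs ch A];
  try by split=> [|[|[]]] //; left.
split=> [[|[x px E]]|[|[env [qE fE] Tv]]].
- by left.
- right; exists (fenv f); have /= qE := projT1_eq E; first by rewrite qE.
  by subst q; rewrite -(inj_pair2 _ _ _ _ _ E).
- by left.
- by right; subst q env; exists v.
Qed.

Lemma step_approx_le (doc : node) (q0 : query) (c c' : config q0) (ev : event) :
  step doc c ev c' -> le_qmap (approx c) (approx c').
Proof. by move=> st q v cv; apply/(step_approx _ st); left. Qed.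

Lemma step_produce_env (doc : node) (q0 : query) (c c' : config q0)
    (q : query) (env : qmap) :
  step doc c (EvProduce q env) c' ->
  exists f, [/\ List.In f (stack c), fquery f = q, fenv f = env
    & forall v, ~ demanded doc f v].
Proof.
move: {-2}(EvProduce _ _) (erefl (EvProduce q env)) => ev evE st.
case: st evE => // M C f fs ch nd q' produced M' [<- <-].
by exists f; split=> //; left.
Qed.

(** The nonempty stack excludes the opening of a new round, the only step that empties the cache. *)
Lemma step_cache (doc : node) (q0 : query) (c c' : config q0) (ev : event) :
  step doc c ev c' -> stack c <> [::] -> cache c `<=` cache c'.
Proof. by case=> //= * u Cu; first [exact: Cu | left]. Qed.

(** The flag tests [produced] against the old answers, and [upd] leaves the map unchanged exactly
    when this inclusion holds. *)
Lemma step_changed (doc : node) (q0 : query) (c c' : config q0) (ev : event) :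
  step doc c ev c' -> stack c <> [::] ->
  changed c' = false <-> changed c = false /\ approx c' = approx c.
Proof.
case=> {c c' ev} //= [M C f fs ch v _ _|M C f fs ch v _ _ _|M C f fs ch v _ _ _
  |M C f fs ch nd|M C fs ch A] _; try by split=> [|[]].
split=> [/norP[/negPf-> /negPn/asboolP pM]|[-> ME]].
  by split=> //; apply: qmap_eq; [apply: upd_le pM => ?|exact: le_upd].
by rewrite /=; apply/negbTE/negPn/asboolP; rewrite -ME updE; right.
Qed.

Lemma step_new_round (doc : node) (q0 : query) (c c' : config q0) (ev : event) :
  step doc c ev c' -> stack c' = [:: new_frame q0] ->
  result c' = None ->
  cache c' = set0 /\ changed c' = false.
Proof.
(* An answered frame has a nonempty [fread], so it is never a fresh one. *)
have nA g v A fs : @answer g v A :: fs <> [:: new_frame q0].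
  move=> /(congr1 (fun s => fread (head g s) v)) /= E.
  by suff: False by []; rewrite -E; right.
case=> {c c' ev} //= [M C f fs ch v _ _|M C f fs ch v _ _ _
  |M C f [|g gs] ch nd] //; by move/nA.
Qed.

(** * Rounds without re-entry *)

(** Only the lower bounds by [lfp] are recorded; the upper bounds come from [sound_config]. *)
Record exact_config (doc : node) (q0 : query) (c : config q0) : Prop := {
  exact_fread : forall f v, List.In f (stack c) -> fread f v ->
    cache c v /\ lfp (TP doc) v `<=` @fenv f v;
  exact_cache : forall q, cache c q -> lfp (TP doc) q `<=` approx c q }.

Lemma exact_step (doc : node) (q0 : query) (c c' : config q0) (ev : event) :
  step doc c ev c' -> (forall u v, ev <> EvReenter u v) ->
  exact_config doc c -> exact_config doc c'.
Proof.
case=> {c c' ev} [M C f fs ch v dv Cv|M C f fs ch v dv _ _|M C f fs ch v dv _ _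
  |M C f fs ch nd q produced M'|M C|M C|//] nre [/= ef ec].
- split=> //= g u [<-|gs]; last by apply: ef; right.
  case=> [fu|->]; last by split=> // x /(ec _ Cv); rewrite /= updE; right.
  have [Cu lu] := ef f u (or_introl erefl) fu.
  by split=> // x /lu; exact: le_upd.
- by case: (nre (fquery f) v).
- by split=> //= g u [<- //|]; exact: ef.
- have M'q : lfp (TP doc) q `<=` M' q.
    move=> x; rewrite -[in X in X -> _]lfp_fixed /M' updE => lx; right.
    (* Everything the finished frame reads was answered with at least [lfp], so by locality its
       evaluation yields all of [TP] at [lfp], that is, all of [lfp]. *)
    apply: TP_local lx => u /(reads_fread nd) fu.
    by have [] := ef f u (or_introl erefl) fu.
  split=> /=.
  + case: fs ef => [|g gs] //= ef h u [<-|hs] hu; last first.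
      have [Cu lu] := ef h u (or_intror (or_intror hs)) hu.
      by split=> //; left.
    case: hu => [hu|->]; last first.
      by split; [right|move=> x /M'q M'x; rewrite /= updE; right].
    have [Cu lu] := ef g u (or_intror (or_introl erefl)) hu.
    by split; [left|move=> x /lu; exact: le_upd].
  + by move=> u [/ec lu|-> //] x /lu; exact: le_upd.
- by split=> //= f v [<-|].
- by split.
Qed.

(** * Rounds that leave the accumulator unchanged *)

(** [M] is a parameter so that it can stand for the one accumulator of a whole stable round. A
    re-entered query may be cached only after its reader, hence the stack alternative in
    [closed_reads]; it vanishes when the round ends. *)
Record closed_config (doc : node) (M : qmap) (q0 : query) (c : config q0)
    : Prop := {
  closed_fread : forall f v, List.In f (stack c) -> fread f v ->
    M v `<=` @fenv f v;
  closed_TP : forall q, cache c q -> TP doc M q `<=` M q;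
  closed_reads : forall q v, cache c q -> reads doc M q v ->
    cache c v \/ on_stack (stack c) v }.

Lemma closed_step (doc : node) (q0 : query) (c c' : config q0) (ev : event) :
  step doc c ev c' -> stack c <> [::] -> approx c' = approx c ->
  sound_config doc c ->
  closed_config doc (approx c) c -> closed_config doc (approx c) c'.
Proof.
have visited_answer (C : set query) f fs v A u :
    C u \/ on_stack (f :: fs) u -> C u \/ on_stack (@answer f v A :: fs) u.
  case=> [|[g [<-|gs] <-]]; [by left|right|right].
    by exists (answer f A) => //; left.
  by exists g => //; right.
have closed_answer (M : qmap) C f fs ch v :
    closed_config doc M (@Config q0 M C (f :: fs) ch None) ->
    closed_config doc M (@Config q0 M C (answer f (M v) :: fs) ch None).
  case=> /= cf cT cr; split=> //= [g u [<-|gs]|q u Cq Mu].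
  - case=> [fu|->] x; last by rewrite /= updE; right.
    by move/(cf f u (or_introl erefl) fu); exact: le_upd.
  - by apply: cf; right.
  - by apply: visited_answer; exact: cr Mu.
case=> {c c' ev} [M C f fs ch v dv Cv|M C f fs ch v dv _ _|M C f fs ch v dv _ _
  |M C f fs ch nd q produced M'|M C|M C|//] //= _ ME sc.
- exact: closed_answer.
- exact: closed_answer.
- case=> /= cf cT cr; split=> //= [g u [<- //|]|u w Cu Mw]; first exact: cf.
  case: (cr _ _ Cu Mw) => [|[g gs gw]]; first by left.
  by right; exists g => //; right.
- case=> /= cf cT cr.
  (* This feeds both locality lemmas: evaluation and reads under [M] are covered by those under the
     environment of the frame. *)
  have fr u : reads doc (fenv f) q u -> M u `<=` @fenv f u.
    by move/(reads_fread nd); apply: cf; left.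
  have popped u : C u \/ on_stack (f :: fs) u ->
      (C `|` [set q]) u \/
      on_stack (if fs is g :: gs then answer g (M' q) :: gs else [::]) u.
    case=> [|[g [<-|gs] <-]]; [by left; left|by left; right|right].
    case: fs gs {sc cf cr} => [|h hs] //= [<-|gs].
      by exists (answer h (M' q)) => //; left.
    by exists g => //; right.
  split=> /=.
  + case: fs {sc popped cr} cf => [|g gs] //= cf h u [<-|hs]; last first.
      by apply: cf; right; right.
    (* The caller receives [M' q], which is [M q] because the step adds nothing. *)
    case=> [gu|-> x]; last by rewrite ME /= updE; right.
    by move=> x /(cf g u (or_intror (or_introl erefl)) gu); exact: le_upd.
  + move=> u [/cT //|->] x /(TP_local fr) px.
    by rewrite -[in X in X q]ME /M' updE; right.
  + move=> u w [Cu Mw|-> /(reads_local fr)/(reads_fread nd) fw].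
      by apply: popped; exact: cr Mw.
    by apply: popped; apply: (fread_visited sc) fw; left.
Qed.

(** * Executions and their rounds *)

Lemma interval_ind (P : nat -> Prop) (i j : nat) :
  i <= j -> P i -> (forall k, i <= k < j -> P k -> P k.+1) -> P j.
Proof.
move=> ij Pi PS; have : i <= j <= j by rewrite ij leqnn.
(* Only the upper bound stays at [j]; the other occurrences become the induction variable. *)
move: {1 2 4}j => k; elim: k => [|k IH] /andP[ik kj].
  by move: ik Pi; rewrite leqn0 => /eqP ->.
move: ik; rewrite leq_eqVlt => /orP[/eqP <- //|ik].
by apply: PS; [rewrite -ltnS ik|apply: IH; rewrite -ltnS ik /= ltnW].
Qed.

Lemma execution_sound (doc : node) (q0 : query) (e : nat -> config q0)
    (ev : nat -> event) :
  execution doc e ev -> forall i, sound_config doc (e i).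
Proof.
case=> e0 eS; elim=> [|i IH]; first by rewrite e0; exact: sound_init.
exact: sound_step (eS i) IH.
Qed.

Lemma execution_approx_le (doc : node) (q0 : query) (e : nat -> config q0)
    (ev : nat -> event) :
  execution doc e ev ->
  forall i j, i <= j -> le_qmap (approx (e i)) (approx (e j)).
Proof.
case=> _ eS i j ij.
apply: (interval_ind (P := fun k => le_qmap (approx (e i)) (approx (e k))) ij).
  by move=> q v.
by move=> k _ IH q v /IH; exact: step_approx_le (eS k) q v.
Qed.

Lemma approx_produced (doc : node) (q0 : query) (e : nat -> config q0)
    (ev : nat -> event) :
  execution doc e ev ->
  forall i q (v : ans q), approx (e i) q v -> produced_before doc e ev i v.
Proof.
move=> run; have [e0 eS] := run; elim=> [|i IH] q v; first by rewrite e0.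
case/(step_approx v (eS i)) => [/IH [k [env [ki evk le Tv]]]|[env evi Tv]].
  by exists k, env; split=> //; exact: ltnW.
exists i, env; split=> //.
have := eS i; rewrite evi => /step_produce_env [f [fs _ <- _]].
exact: fenv_approx (execution_sound run i) f fs.
Qed.

Lemma round_start (doc : node) (q0 : query) (e : nat -> config q0)
    (ev : nat -> event) (i j : nat) :
  execution doc e ev -> round e i j ->
  cache (e i) = set0 /\ changed (e i) = false.
Proof.
move=> run [_ si _ _]; have [e0 eS] := run.
case: i si => [|i] si; first by rewrite e0.
apply: (step_new_round (eS i) si).
(* A returned configuration has an empty stack, unlike the start of a round. *)
case rE: (result _) => [A|] //.
by have [] := result_final (execution_sound run i.+1) rE; rewrite si.
Qed.

Lemma round_changed (doc : node) (q0 : query) (e : nat -> config q0)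
    (ev : nat -> event) (i j : nat) :
  execution doc e ev -> round e i j ->
  changed (e j) = false <-> stable e i j.
Proof.
move=> run r; have [_ ci] := round_start run r.
have [_ eS] := run; have [ij _ sk _] := r.
suff H : changed (e j) = false <-> approx (e j) = approx (e i).
  split=> [/H E q|st]; first by rewrite E.
  apply/H; exact: functional_extensionality_dep.
apply: (interval_ind
  (P := fun k => changed (e k) = false <-> approx (e k) = approx (e i))
  (ltnW ij)) => // k ikj IH.
split=> [/(step_changed (eS k) (sk k ikj)) [/IH <- //]|E].
have [ik _] := andP ikj.
(* By monotonicity, an accumulator back at its initial value after step [k] had that value before it
   too. *)
have kE : approx (e k) = approx (e i).
  apply: qmap_eq; last exact: execution_approx_le run _ _ ik.
  by rewrite -E; exact: execution_approx_le run _ _ (leqnSn k).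
by apply/(step_changed (eS k) (sk k ikj)); rewrite E kE; split=> //; exact/IH.
Qed.

Lemma round_cache_le (doc : node) (q0 : query) (e : nat -> config q0)
    (ev : nat -> event) (i j k : nat) :
  execution doc e ev -> round e i j -> i <= k <= j ->
  cache (e k) `<=` cache (e j).
Proof.
move=> [_ eS] [_ _ sk _] /andP[ik kj].
apply: (interval_ind (P := fun m => cache (e k) `<=` cache (e m)) kj).
  by move=> q.
move=> m /andP[km mj] IH q /IH.
by apply: step_cache (eS m) _ q; apply: sk; rewrite (leq_trans ik km).
Qed.

Lemma round_q0 (doc : node) (q0 : query) (e : nat -> config q0)
    (ev : nat -> event) (i j : nat) :
  execution doc e ev -> round e i j -> cache (e j) q0.
Proof.
move=> run [_ _ _ sj]; case: (q0_visited (execution_sound run j)) => //.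
by rewrite sj => -[].
Qed.

Lemma round_exact (doc : node) (q0 : query) (e : nat -> config q0)
    (ev : nat -> event) (i j k : nat) :
  execution doc e ev -> round e i j -> ~ reentered ev i j -> i <= k <= j ->
  exact_config doc (e k).
Proof.
move=> run r nre /andP[ik kj]; have [ci _] := round_start run r.
have [_ eS] := run; have [_ si _ _] := r.
apply: (interval_ind (P := fun m => exact_config doc (e m)) ik).
  by split=> [f v|q]; rewrite ?si ?ci // => -[<-|].
move=> m /andP[im mk]; apply: exact_step (eS m) _ => u v evm; apply: nre.
by exists m, u, v; rewrite im (leq_trans mk kj).
Qed.

Lemma round_stable (doc : node) (q0 : query) (e : nat -> config q0)
    (ev : nat -> event) (i j : nat) :
  execution doc e ev -> round e i j -> stable e i j ->
  closed_config doc (approx (e j)) (e j).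
Proof.
move=> run r st; have [ci _] := round_start run r.
have [_ eS] := run; have [ij si sk _] := r.
(* Every intermediate accumulator is squeezed between two equal ones. *)
have kE k : i <= k <= j -> approx (e k) = approx (e j).
  case/andP=> ik kj.
  apply: qmap_eq; first exact: execution_approx_le run _ _ kj.
  by move=> q; rewrite st; exact: execution_approx_le run _ _ ik q.
apply: (interval_ind
  (P := fun k => closed_config doc (approx (e j)) (e k)) (ltnW ij)).
  by split=> [f v|q|q v]; rewrite ?si ?ci // => -[<-|].
move=> k ikj; have [ik kj] := andP ikj.
have Ek : approx (e k) = approx (e j) by apply: kE; rewrite ik ltnW.
have ESk : approx (e k.+1) = approx (e j) by apply: kE; rewrite leqW.
rewrite -Ek; apply: closed_step (eS k) (sk k ikj) _ _.
- by rewrite ESk.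
- exact: execution_sound run _.
Qed.

(** Because [C] is closed under reads, locality keeps the arbitrary answers of [N] outside [C] from
    affecting evaluation inside [C]. *)
Lemma lfp_closed_le (doc : node) (M : qmap) (C : set query) :
  (forall q, C q -> TP doc M q `<=` M q) ->
  (forall q v, C q -> reads doc M q v -> C v) ->
  forall q, C q -> lfp (TP doc) q `<=` M q.
Proof.
move=> CT Cr q Cq v lv.
pose N : qmap := fun u => [set x | C u -> M u x].
suff /lfp_least/(_ _ _ lv) : le_qmap (TP doc N) N by apply.
move=> u x Nx Cu; apply: CT => //; apply: TP_local Nx => w Mw y Ny.
by apply: Ny; exact: Cr Mw.
Qed.

(** The cache is closed under reads by the accumulator, whereas [reachable] follows reads by [lfp].
    Since [lfp] is below the accumulator on the cache, locality turns the latter reads into the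
    former, and the cache contains every reachable query. *)
Lemma round_stable_lfp (doc : node) (q0 : query) (e : nat -> config q0)
    (ev : nat -> event) (i j : nat) :
  execution doc e ev -> round e i j -> stable e i j ->
  forall q, reachable doc q0 q ->
    cache (e j) q /\ approx (e j) q = lfp (TP doc) q.
Proof.
move=> run r st; have [_ cT cr] := round_stable run r st.
have sj : stack (e j) = [::] by case: r.
have Cr q v : cache (e j) q -> reads doc (approx (e j)) q v -> cache (e j) v.
  by move=> Cq /(cr _ _ Cq) []//; rewrite sj => -[].
have ll := lfp_closed_le cT Cr.
have sound := approx_sound (execution_sound run j).
suff cC q : reachable doc q0 q -> cache (e j) q.
  by move=> q /cC Cq; split=> //; apply/seteqP; split; [exact: sound|exact: ll].
move=> /clos_rt_rtn1_iff; elim=> [|u v uv _ Cu]; first exact: round_q0 run r.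
apply: (Cr u) => //; apply: reads_local uv => w Mw; apply: ll; exact: Cr Mw.
Qed.

(** * The round behind a returned answer *)

Lemma step_empty_stack (doc : node) (q0 : query) (c c' : config q0)
    (ev : event) :
  step doc c ev c' -> stack c = [::] ->
  stack c' = [:: new_frame q0] \/
  [/\ stack c' = [::], approx c' = approx c & changed c' = changed c].
Proof. by case=> //= *; [left|right|right]. Qed.

Lemma return_round (doc : node) (q0 : query) (e : nat -> config q0)
    (ev : nat -> event) :
  execution doc e ev -> forall k, stack (e k) = [::] ->
  exists i j, [/\ round e i j, approx (e j) = approx (e k)
                & changed (e j) = changed (e k)].
Proof.
move=> [e0 eS] k sk0.
(* Induction on time: either the last round is over and its final accumulator and flag persist, as
   they do while idling, or a round begun at [i] is still open. *)
suff: (exists i j, [/\ round e i j, approx (e j) = approx (e k)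
        & changed (e j) = changed (e k)] /\ stack (e k) = [::]) \/
      exists i, [/\ i <= k, stack (e i) = [:: new_frame q0]
        & forall m, i <= m <= k -> stack (e m) <> [::]].
  case=> [[i [j [r _]]]|[i [ik _ /(_ k)]]]; first by exists i, j.
  by rewrite ik leqnn sk0 => /(_ erefl).
elim: k {sk0} => [|k IH].
  by right; exists 0; split=> // [|[|m]]; rewrite ?e0.
have new m : stack (e m) = [:: new_frame q0] -> exists i, [/\ i <= m,
    stack (e i) = [:: new_frame q0]
    & forall n, i <= n <= m -> stack (e n) <> [::]].
  move=> sm; exists m; split=> // n.
  by rewrite -eqn_leq => /eqP <-; rewrite sm.
case: IH => [[i [j [[r jk cjk] sk]]]|[i [ik si nk]]].
  case: (step_empty_stack (eS k) sk) => [/new|[sk' -> ->]]; first by right.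
  by left; exists i, j.
have nk' m : i <= m < k.+1 -> stack (e m) <> [::] by rewrite ltnS; exact: nk.
case sk: (stack (e k.+1)) => [|f fs].
  left; exists i, k.+1; split=> //; split=> //; split=> //.
right; exists i; split=> //; first exact: leqW.
move=> m /andP[im]; rewrite leq_eqVlt => /orP[/eqP ->|mk]; first by rewrite sk.
by apply: nk'; rewrite im.
Qed.

Theorem theoremA10 (doc : node) (q0 : query)
    (e : nat -> config q0) (ev : nat -> event)
    (run : execution doc e ev) :
  (* (1) soundness *)
  ((forall i q (v : ans q), approx (e i) q v ->
      produced_before doc e ev i v /\ lfp (TP doc) q v) /\
   (forall i A (v : ans q0), result (e i) = Some A -> A v ->
      produced_before doc e ev i v /\ lfp (TP doc) q0 v)) /\
  (* (2) monotone accumulation *)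
  ((forall i q (v : ans q), approx (e i.+1) q v <->
      approx (e i) q v \/
      exists2 env, ev i = EvProduce q env & TP doc env q v) /\
   (forall i j, i <= j -> le_qmap (approx (e i)) (approx (e j)))) /\
  (* (3) correct fixpoint detection: no re-entry *)
  (forall i j, round e i j -> ~ reentered ev i j ->
     [/\ forall k q env, i <= k < j -> ev k = EvProduce q env ->
           forall v, reads doc env q v ->
             cache (e j) v /\ env v = lfp (TP doc) v,
         forall q, cache (e j) q -> approx (e j) q = lfp (TP doc) q
       & approx (e j) q0 = lfp (TP doc) q0]) /\
  (* (3) correct fixpoint detection: stable accumulator *)
  ((forall M, le_qmap (TP doc M) M -> le_qmap (lfp (TP doc)) M) /\
   (TP doc (lfp (TP doc)) = lfp (TP doc)) /\
   (forall i j, round e i j -> (changed (e j) = false <-> stable e i j)) /\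
   (forall i j, round e i j -> stable e i j ->
      [/\ le_qmap (approx (e j)) (lfp (TP doc)),
          forall q, reachable doc q0 q ->
            TP doc (approx (e j)) q `<=` approx (e j) q
        & forall q, approx (e j) q =
            [set v | reachable doc q0 q /\ lfp (TP doc) q v]])) /\
  (* (4) sound failure *)
  ((forall i j, round e i j -> ~ stable e i j) ->
     forall i, result (e i) = None) /\
  (forall i A, result (e i) = Some A -> A = lfp (TP doc) q0).
Proof.
have sound := execution_sound run; have approx_le := execution_approx_le run.
have [e0 eS] := run.
have facts i q (v : ans q) : approx (e i) q v ->
    produced_before doc e ev i v /\ lfp (TP doc) q v.
  move=> iv; split; first exact: approx_produced.
  exact: approx_sound (sound i) q v iv.
(* The flag is false on return and equals the flag at the end of the last round, so that round was
   stable. *)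
have returned i A : result (e i) = Some A ->
    A = approx (e i) q0 /\ exists k l, [/\ round e k l, stable e k l
      & approx (e l) = approx (e i)].
  move/(result_final (sound i)) => [si ci ->]; split=> //.
  have [k [l [r lE cE]]] := return_round run si.
  exists k, l; split=> //; apply/(round_changed run r); by rewrite cE.
split; [split=> // i A v /returned[-> _]; exact: facts|].
split; [split=> // i q v; exact: step_approx (eS i)|].
split.
  move=> i j r nre.
  have exact_lfp k q : i <= k <= j -> cache (e k) q ->
      approx (e k) q = lfp (TP doc) q.
    move=> ikj Cq; apply/seteqP; split; first exact: approx_sound (sound k) q.
    exact: exact_cache (round_exact run r nre ikj) q Cq.
  have ijj : i <= j <= j by case: r => /ltnW ->; rewrite leqnn.
  split=> [k q env|q|].
  - case/andP=> ik kj evk v rv.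
    have ikj : i <= k <= j by rewrite ik ltnW.
    have := eS k; rewrite evk => /step_produce_env [f [fs fq fE nd]].
    have fv : fread f v by apply: (reads_fread nd); rewrite fE fq.
    have [Cv lv] := exact_fread (round_exact run r nre ikj) fs fv.
    rewrite fE in lv; split; first exact: round_cache_le run r ikj v Cv.
    (* The remaining inclusion holds because the environment is below the accumulator, which is
       sound. *)
    apply/seteqP; split=> // x vx; apply: (approx_sound (sound k)).
    by apply: (fenv_approx (sound k) fs); rewrite fE.
  - exact: exact_lfp.
  - exact: exact_lfp ijj (round_q0 run r).
split.
  split; first exact: lfp_least.
  split; first exact: lfp_fixed.
  split=> i j r; first exact: round_changed run r.
  move=> st; have stE := round_stable_lfp run r st.
  split; first exact: approx_sound.
    move=> q /stE[Cq _]; exact: closed_TP (round_stable run r st) q Cq.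
  move=> q; apply/seteqP; split=> v.
    move=> qv; split; last exact: approx_sound qv.
    exact: approx_reachable (sound j) q v qv.
  by case=> /stE[_ ->].
split=> [nst i|i A /returned[-> [k [l [r st <-]]]]]; last first.
  by have [] := round_stable_lfp run r st (rt_refl _ _ _).
(* A result would exhibit a stable round, against the hypothesis. *)
case rE: (result (e i)) => [A|//].
by have [_ [k [l [r st _]]]] := returned i A rE; case: (nst k l r).
Qed.
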